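(* For all $h\in\mathbb{F}$ and all $p\in\mathbb{F}^*$ with $p\neq 1$, the operator $B_{p,h,n}$ is a solution of the modified quantum Yang-Baxter equation (MQYBE) and is similar to $Q_p$.
   Context: $\mathbb{F}$ is an algebraically closed field of characteristic zero and $n$ is a positive integer. The following are linear operators on the field of rational functions $\mathbb{F}(z_1,z_2)$, where rational functions act by multiplication: $(P\cdot f)(z_1,z_2)=f(z_2,z_1)$, $(F_p\cdot f)(z_1,z_2)=f(p^{-1}z_1,pz_2)$, $(\tilde F_{p,h}\cdot f)(z_1,z_2)=f(p^{-1}z_1+p^{-1}h,\,pz_2-h)$. Define $$Q_p=F_p-\frac{(p^n-1)(z_2+p^{-1}z_1)}{(p^n+1)(z_2-p^{-1}z_1)}(F_p-P)$$ (the modified one-parameter Cremmer-Gervais operator) and $$B_{p,h,n}=\tilde F_{p,h}-\frac{(p^n-1)(pz_2+z_1)}{(p^n+1)(pz_2-z_1-h)}(\tilde F_{p,h}-P)+\frac{h(p^n-1)(p+1)}{(p^n+1)(p-1)(pz_2-z_1-h)}(\tilde F_{p,h}-P).$$ An operator $R=\sum_i\alpha_i(z_1,z_2)\sigma_i$ with $\alpha_i\in\mathbb{F}(z_1,z_2)$ and $\sigma_i\in\operatorname{Aut}\mathbb{F}(z_1,z_2)$ gives operators $R_{ij}$ on $\mathbb{F}(z_1,z_2,z_3)$ by letting $R$ act in the variables $z_i,z_j$ (in place of $z_1,z_2$), with the automorphisms extended to $\mathbb{F}(z_i,z_j)(z_k)$ by acting on coefficients. Such an $R$ satisfies the MQYBE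 if $$R_{12}R_{13}R_{23}-R_{23}R_{13}R_{12}=\lambda\,(P_{123}R_{12}-P_{213}R_{23})$$ for some nonzero $\lambda\in\mathbb{F}$. Here $P_{ijk}$ is the permutation operator $P_{ijk}(v_1\otimes v_2\otimes v_3)=v_{\sigma(1)}\otimes v_{\sigma(2)}\otimes v_{\sigma(3)}$, where $\sigma$ is the permutation (cycle) $(ijk)$; on functions, with $v_1\otimes v_2\otimes v_3$ identified with $v_1(z_1)v_2(z_2)v_3(z_3)$, this reads $(P_{123}f)(z_1,z_2,z_3)=f(z_3,z_1,z_2)$ and $(P_{213}f)(z_1,z_2,z_3)=f(z_2,z_3,z_1)$. Two operators on $\mathbb{F}(z_1,z_2)$ are similar if one is the conjugate of the other by an invertible linear operator on $\mathbb{F}(z_1,z_2)$.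
   Formalization: The MQYBE is claimed only when p^n ≠ 1, since for p^n = 1 it would force λ = 0; p^n ≠ -1 is assumed so that the operators are defined; operator products in the MQYBE are composed from left to right, as it fails right-to-left with the displayed P_123, P_213. *)

(* Defs.v *)
From mathcomp Require Import all_boot all_order all_algebra.
From mathcomp Require Import mpoly.

Set Implicit Arguments.
Unset Strict Implicit.
Unset Printing Implicit Defensive.

Import GRing.Theory.
Local Open Scope ring_scope.

Section RationalFunctions.

Variable F : fieldType.

Definition ratfun (n : nat) : fieldType := {fraction {mpoly F[n]}}.

Definition cst (n : nat) (c : F) : ratfun n :=
  @tofrac {mpoly F[n]} c%:MP.

Definition var (n : nat) (i : 'I_n) : ratfun n :=
  @tofrac {mpoly F[n]} 'X_i.

Definition num (n : nat) (f : ratfun n) : {mpoly F[n]} :=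
  \n_(repr f).

Definition den (n : nat) (f : ratfun n) : {mpoly F[n]} :=
  \d_(repr f).

(* f(v_0, ..., v_(n-1)). This is the usual substitution when the v_i are
   algebraically independent over F, which is the case in all uses below; for
   other v the denominator may vanish at v and the value is then irrelevant. *)
Definition subst (n m : nat) (v : 'I_n -> ratfun m) (f : ratfun n) : ratfun m :=
  mmap (@cst m) v (num f) / mmap (@cst m) v (den f).

Definition subst2 (m : nat) (f : ratfun 2) (a b : ratfun m) : ratfun m :=
  subst (tnth [tuple a; b]) f.

Definition subst3 (m : nat) (f : ratfun 3) (a b c : ratfun m) : ratfun m :=
  subst (tnth [tuple a; b; c]) f.

(* The mathematical indices 1, 2, 3 of the variables z_1, z_2, z_3. *)
Definition i1 : 'I_3 := @Ordinal 3 0 isT.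
Definition i2 : 'I_3 := @Ordinal 3 1 isT.
Definition i3 : 'I_3 := @Ordinal 3 2 isT.

Definition z1 : ratfun 2 := var (@Ordinal 2 0 isT).
Definition z2 : ratfun 2 := var (@Ordinal 2 1 isT).
Local Notation k := (@cst 2).

Definition Pop (f : ratfun 2) : ratfun 2 := subst2 f z2 z1.

Definition Fop (p : F) (f : ratfun 2) : ratfun 2 :=
  subst2 f (k p^-1 * z1) (k p * z2).

Definition tFop (p h : F) (f : ratfun 2) : ratfun 2 :=
  subst2 f (k p^-1 * z1 + k (p^-1 * h)) (k p * z2 - k h).

Definition Qop (p : F) (n : nat) (f : ratfun 2) : ratfun 2 :=
  Fop p f
  - (k (p ^+ n - 1) * (z2 + k p^-1 * z1))
    / (k (p ^+ n + 1) * (z2 - k p^-1 * z1)) * (Fop p f - Pop f).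

Definition Bop (p h : F) (n : nat) (f : ratfun 2) : ratfun 2 :=
  tFop p h f
  - (k (p ^+ n - 1) * (k p * z2 + z1))
    / (k (p ^+ n + 1) * (k p * z2 - z1 - k h)) * (tFop p h f - Pop f)
  + k (h * (p ^+ n - 1) * (p + 1))
    / (k ((p ^+ n + 1) * (p - 1)) * (k p * z2 - z1 - k h))
    * (tFop p h f - Pop f).

Definition linear_op (T : ratfun 2 -> ratfun 2) : Prop :=
  (forall f g, T (f + g) = T f + T g) /\ (forall c f, T (k c * f) = k c * T f).

Definition similar_op (A B : ratfun 2 -> ratfun 2) : Prop :=
  exists T T' : ratfun 2 -> ratfun 2,
    [/\ linear_op T, cancel T T', cancel T' T & A =1 T \o B \o T'].

Record autF := AutF {
  aut_fun :> {rmorphism ratfun 2 -> ratfun 2};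
  aut_bij : bijective aut_fun;
  aut_cst : forall c : F, aut_fun (k c) = k c
}.

Definition embed (i j : 'I_3) (f : ratfun 2) : ratfun 3 :=
  subst2 f (var i) (var j).

(* The extension of s, carried to F(z_i, z_j), to F(z_i, z_j)(z_l) by acting on
   coefficients, {i, j, l} = {1, 2, 3}: since s fixes F, it is the substitution
   z_i |-> s(z_1)(z_i, z_j), z_j |-> s(z_2)(z_i, z_j), z_l |-> z_l. *)
Definition aut_lift (i j : 'I_3) (s : autF) (f : ratfun 3) : ratfun 3 :=
  subst (fun l => if l == i then embed i j (s z1)
                  else if l == j then embed i j (s z2)
                  else var l) f.

Definition sum_op (r : seq (ratfun 2 * autF)) (f : ratfun 2) : ratfun 2 :=
  \sum_(t <- r) t.1 * t.2 f.

Definition sum_lift (r : seq (ratfun 2 * autF)) (i j : 'I_3) (f : ratfun 3) :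
    ratfun 3 :=
  \sum_(t <- r) embed i j t.1 * aut_lift i j t.2 f.

Definition P123 (f : ratfun 3) : ratfun 3 := subst3 f (var i3) (var i1) (var i2).
Definition P213 (f : ratfun 3) : ratfun 3 := subst3 f (var i2) (var i3) (var i1).

(* Distinct automorphisms are linearly independent over F(z_1, z_2), so that
   sum_lift r i j depends only on the operator R = sum_op r.

   Products of operators on F(z_1, z_2, z_3) are composed from left to right:
   (X \; Y) f = Y (X f). Because X_23 (P213 f) = P213 (X_12 f) and
   X_12 (P123 f) = P123 (X_23 f), the equation below is the same, with the same
   lambda, as the one with right-to-left products and P123, P213 replaced by
   their inverses P213, P123. Right-to-left products with P123, P213 as above
   cannot be meant: with h = 0, the right-hand side of the equation for Bop
   would contain f(z_3/p, p z_1, z_2) and f(z_2, z_3/p, p z_1), while the only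
   cyclic terms on the left are f(z_3, z_1/p, p z_2) and f(z_2/p, p z_3, z_1). *)
Definition MQYBE (R : ratfun 2 -> ratfun 2) : Prop :=
  exists r : seq (ratfun 2 * autF), R =1 sum_op r /\
    let R12 := sum_lift r i1 i2 in
    let R13 := sum_lift r i1 i3 in
    let R23 := sum_lift r i2 i3 in
    exists lambda : F, lambda != 0 /\
      forall f : ratfun 3,
        (R12 \; R13 \; R23) f - (R23 \; R13 \; R12) f
        = cst 3 lambda * ((P123 \; R12) f - (P213 \; R23) f).

End RationalFunctions.

(* Main.v *)
(* In the coordinates w_i = z_i - c, where c = h / (p - 1) is the common fixed
   point of z |-> (z + h) / p and z |-> p z - h, the operator B_{p,h,n} takes
   the form Q_p; hence it is the conjugate of Q_p by the translation by c.
   Writing w for (w_1, w_2, w_3), each R_ij sends a function f of w to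
     (1 - g) f(.., w_i / p, .., p w_j, ..) + g f(.., w_j, .., w_i, ..)
   with g = mu (p w_j + w_i) / (p w_j - w_i), mu = (p^n - 1) / (p^n + 1). Both
   sides of the MQYBE with lambda = mu^2 are thus combinations of six values of
   f, and comparing the coefficients leaves identities between rational
   functions of p, mu and w. *)

From HB Require Import structures.
Require Import Defs.
From mathcomp Require Import all_boot all_order all_algebra perm.
From mathcomp Require Import mpoly.
From mathcomp Require Import ring.

Import GRing.Theory.
Local Open Scope ring_scope.

Set Implicit Arguments.
Unset Strict Implicit.
Unset Printing Implicit Defensive.

(** * The equation as a pointwise identity in three coordinates *)

Section CremmerGervais.
Variables (K : fieldType) (p mu : K).
Definition cg_coef (x y : K) := mu * ((p * y + x) / (p * y - x)).
Definition cg_op (x y f fP : K) := (1 - cg_coef x y) * f + cg_coef x y * fP.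
(** Arbitrary functions on triples stand in for rational functions, so that the values of [f] are
    mere atoms for [field]. *)
Definition cg12 (f : K -> K -> K -> K) x y z :=
  cg_op x y (f (p^-1 * x) (p * y) z) (f y x z).
Definition cg13 (f : K -> K -> K -> K) x y z :=
  cg_op x z (f (p^-1 * x) y (p * z)) (f z y x).
Definition cg23 (f : K -> K -> K -> K) x y z :=
  cg_op y z (f x (p^-1 * y) (p * z)) (f x z y).

(** Up to sign and powers of [p], the denominators are the three in the hypotheses. The one with
    [p * (p * z)] comes from [cg13] taken where [x] or [z] has already been rescaled. *)
Lemma cg_mqybe (f : K -> K -> K -> K) x y z :
    p != 0 -> p * y - x != 0 -> p * z - y != 0 -> p * (p * z) - x != 0 ->
  cg23 (cg13 (cg12 f)) x y z - cg12 (cg13 (cg23 f)) x y z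
  = mu ^+ 2 * (cg12 (fun a b c => f c a b) x y z
               - cg23 (fun a b c => f b c a) x y z).
Proof.
move=> p0 xy yz xz; rewrite /cg12 /cg13 /cg23 /cg_op.
rewrite !(mulKf p0) !(mulVKf p0) /cg_coef; field.
rewrite p0 xy xz yz -mulrBr mulf_neq0 //=.
by rewrite -(opprB (p * y)) -(opprB (p * z)) !oppr_eq0 xy yz.
Qed.

End CremmerGervais.

Lemma rmorph_cg_coef (K L : fieldType) (g : {rmorphism K -> L}) p mu x y :
  g (cg_coef p mu x y) = cg_coef (g p) (g mu) (g x) (g y).
Proof. by rewrite /cg_coef !(rmorphM, fmorphV, rmorphB, rmorphD). Qed.

Lemma cg_op_modified (K : fieldType) (p q x y A B : K) :
    p != 0 -> q + 1 != 0 -> p * y - x != 0 ->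
  A - ((q - 1) * (y + p^-1 * x)) / ((q + 1) * (y - p^-1 * x)) * (A - B)
  = cg_op p ((q - 1) / (q + 1)) x y A B.
Proof.
move=> p0 q0 D0; rewrite /cg_op /cg_coef; field.
by rewrite p0 q0 D0.
Qed.

(** With c = h / (p - 1), the denominator p(y - c) - (x - c) is py - x - h, and the numerator p(y -
    c) + (x - c) is py + x - h(p + 1) / (p - 1); its last term accounts for the extra summand of
    B. *)
Lemma cg_op_affine (K : fieldType) (p q h x y A B : K) :
    p - 1 != 0 -> q + 1 != 0 -> p * y - x - h != 0 ->
  A - ((q - 1) * (p * y + x)) / ((q + 1) * (p * y - x - h)) * (A - B)
    + (h * (q - 1) * (p + 1)) / ((q + 1) * (p - 1) * (p * y - x - h)) * (A - B)
  = cg_op p ((q - 1) / (q + 1)) (x - h / (p - 1)) (y - h / (p - 1)) A B.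
Proof.
move=> p0 q0 D0; rewrite /cg_op /cg_coef; field.
rewrite p0 q0 D0 /=.
have -> : p * (y * (p - 1) - h) - (x * (p - 1) - h) = (p - 1) * (p * y - x - h).
  by ring.
by rewrite mulf_neq0.
Qed.

(** The images enter through equations, so that each can be computed by its own lemma. *)
Lemma rmorph_cg_op (K L : fieldType) (g : {rmorphism K -> L}) p mu x y A B
    p' mu' x' y' A' B' :
    g p = p' -> g mu = mu' -> g x = x' -> g y = y' -> g A = A' -> g B = B' ->
  g (cg_op p mu x y A B) = cg_op p' mu' x' y' A' B'.
Proof.
move=> <- <- <- <- <- <-; rewrite /cg_op -rmorph_cg_coef.
by move: (cg_coef _ _ _ _) => a; rewrite rmorphD !rmorphM rmorphB rmorph1.
Qed.

Lemma sum_seq2 (V : nmodType) (I : Type) (a b : I) (f : I -> V) :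
  \sum_(t <- [:: a; b]) f t = f a + f b.
Proof. by rewrite !big_cons big_nil addr0. Qed.

(** * Evaluation of polynomials *)

Section Mmap.

Variables (n : nat) (R S T : comNzRingType).

Lemma eq_mmap (f f' : R -> S) (v v' : 'I_n -> S) (q : {mpoly R[n]}) :
  f =1 f' -> v =1 v' -> mmap f v q = mmap f' v' q.
Proof.
by move=> eqf eqv; apply: eq_bigr => m _; rewrite eqf (mmap1_eq _ eqv).
Qed.

Lemma rmorph_mmap (g : {rmorphism S -> T}) (f : R -> S) (v : 'I_n -> S)
    (q : {mpoly R[n]}) :
  g (mmap f v q) = mmap (g \o f) (g \o v) q.
Proof.
rewrite rmorph_sum; apply: eq_bigr => m _; rewrite rmorphM rmorph_prod /=.
by congr (_ * _); apply: eq_bigr => i _; rewrite rmorphXn.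
Qed.

Lemma mmap_mpolyX (q : {mpoly R[n]}) :
  mmap (@mpolyC n R) (fun i => 'X_i) q = q.
Proof.
by rewrite [RHS]mpolyE; apply: eq_bigr => m _; rewrite mmap1_id mul_mpolyC.
Qed.

End Mmap.

(** * Substitution in rational functions as a field morphism *)

Section Subst.

Variable F : fieldType.

Lemma cst_is_zmod_morphism n : zmod_morphism (@cst F n).
Proof. by move=> a b; rewrite /cst mpolyCB tofracB. Qed.

Lemma cst_is_monoid_morphism n : monoid_morphism (@cst F n).
Proof. by split=> [|a b]; rewrite /cst ?tofrac1 // mpolyCM tofracM. Qed.

HB.instance Definition _ n :=
  GRing.isZmodMorphism.Build F (ratfun F n) (@cst F n)
    (@cst_is_zmod_morphism n).
HB.instance Definition _ n :=
  GRing.isMonoidMorphism.Build F (ratfun F n) (@cst F n)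
    (@cst_is_monoid_morphism n).

Lemma den_neq0 n (f : ratfun F n) : den f != 0.
Proof. exact: denom_ratioP. Qed.

Lemma num_div_den n (f : ratfun F n) : tofrac (num f) / tofrac (den f) = f.
Proof.
apply: (canLR (mulfK _)); first by rewrite tofrac_eq0 den_neq0.
rewrite /num /den -[f in f * _]reprK; unlock tofrac.
rewrite -[RHS]FracField.pi_mul; apply/eqmodP; rewrite /= FracField.equivfE.
rewrite /FracField.mulf !numden_Ratio ?oner_neq0 //.
  by rewrite mul1r mulr1 mulrC.
all: exact: mulf_neq0 (denom_ratioP _) (oner_neq0 _).
Qed.

(** Algebraic independence over [F]: no nonzero denominator vanishes at [v], which makes [subst v] a
    field morphism. *)
Definition alg_free n m (v : 'I_n -> ratfun F m) :=
  forall q, mmap (@cst F m) v q = 0 -> q = 0.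

Lemma eq_free n m (v v' : 'I_n -> ratfun F m) :
  v =1 v' -> alg_free v -> alg_free v'.
Proof.
by move=> eqv fv q; rewrite -(eq_mmap q (frefl _) eqv) => /fv.
Qed.

Lemma eq_subst n m (v v' : 'I_n -> ratfun F m) f :
  v =1 v' -> subst v f = subst v' f.
Proof. by move=> eqv; rewrite /subst !(eq_mmap _ (frefl _) eqv). Qed.

Section Free.

Variables (n m : nat) (v : 'I_n -> ratfun F m).
Hypothesis free_v : alg_free v.

Local Notation ev := (mmap (@cst F m) v).

Lemma free_mmap_neq0 q : q != 0 -> ev q != 0.
Proof. by apply: contra_neq => /free_v. Qed.

(** [subst] is computed on the representative chosen by [repr]; any other fraction gives the same
    value because [ev] preserves the cross-multiplied equality. *)
Lemma subst_frac a b : b != 0 -> subst v (tofrac a / tofrac b) = ev a / ev b.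
Proof.
move=> b0; rewrite /subst; set f := (_ / _ : ratfun F n).
apply/eqP; rewrite eqr_div ?free_mmap_neq0 ?den_neq0 // -!rmorphM /=.
suff -> : num f * b = a * den f by [].
apply/eqP; rewrite -tofrac_eq !tofracM -eqr_div ?tofrac_eq0 ?den_neq0 //.
by rewrite num_div_den.
Qed.

Lemma subst_tofrac q : subst v (tofrac q) = ev q.
Proof.
by rewrite -[tofrac q]divr1 -tofrac1 subst_frac ?oner_neq0 // rmorph1 divr1.
Qed.

Lemma subst_cst a : subst v (cst n a) = cst m a.
Proof. by rewrite subst_tofrac mmapC. Qed.

Lemma subst_var i : subst v (var F i) = v i.
Proof. by rewrite subst_tofrac mmapX mmap1U. Qed.

Lemma subst_is_zmod_morphism : zmod_morphism (subst v).
Proof.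
move=> f g; rewrite -[f]num_div_den -[g]num_div_den.
rewrite -mulNr addf_div ?tofrac_eq0 ?den_neq0 // -tofracN -!tofracM -tofracD.
rewrite !subst_frac ?mulf_neq0 ?den_neq0 // !(rmorphD, rmorphM, rmorphN) /=.
by rewrite -[in RHS]mulNr addf_div ?free_mmap_neq0 ?den_neq0.
Qed.

Lemma subst_is_monoid_morphism : monoid_morphism (subst v).
Proof.
split=> [|f g]; first by rewrite -tofrac1 subst_tofrac rmorph1.
rewrite -[f]num_div_den -[g]num_div_den mulf_div -!tofracM.
by rewrite !subst_frac ?mulf_neq0 ?den_neq0 // !rmorphM mulf_div.
Qed.

(** The morphism structure depends on [free_v], hence the explicit packing. *)
Definition substm : {rmorphism ratfun F n -> ratfun F m} :=
  HB.pack (subst v)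
    (GRing.isZmodMorphism.Build _ _ (subst v) subst_is_zmod_morphism)
    (GRing.isMonoidMorphism.Build _ _ (subst v) subst_is_monoid_morphism).

Lemma substD f g : subst v (f + g) = subst v f + subst v g.
Proof. exact: (rmorphD substm). Qed.

Lemma substB f g : subst v (f - g) = subst v f - subst v g.
Proof. exact: (rmorphB substm). Qed.

Lemma substM f g : subst v (f * g) = subst v f * subst v g.
Proof. exact: (rmorphM substm). Qed.

Lemma substV f : subst v f^-1 = (subst v f)^-1.
Proof. exact: (fmorphV substm). Qed.

Lemma subst_mmap l (u : 'I_l -> ratfun F n) q :
  subst v (mmap (@cst F n) u q) = mmap (@cst F m) (subst v \o u) q.
Proof.
apply: etrans (rmorph_mmap substm _ _ _) _.
by apply: eq_mmap => // a; apply: subst_cst.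
Qed.

(** A field morphism is injective and this one fixes constants, so it creates no algebraic
    relation. *)
Lemma free_subst l (u : 'I_l -> ratfun F n) :
  alg_free u -> alg_free (fun i => subst v (u i)).
Proof.
move=> free_u q; rewrite -subst_mmap => /eqP.
by rewrite (fmorph_eq0 substm) => /eqP/free_u.
Qed.

Lemma subst_subst l (u : 'I_l -> ratfun F n) f :
  alg_free u -> subst v (subst u f) = subst (fun i => subst v (u i)) f.
Proof. by move=> free_u; rewrite {2}/subst substM substV !subst_mmap. Qed.

End Free.

Lemma subst_id n (f : ratfun F n) : subst (@var F n) f = f.
Proof.
have mmapE q : mmap (@cst F n) (@var F n) q = tofrac q.
  by rewrite -[q in RHS]mmap_mpolyX (rmorph_mmap (@tofrac {mpoly F[n]})).
by rewrite /subst !mmapE num_div_den.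
Qed.

Lemma free_affine n m (s : 'I_n -> 'I_m) (a b : 'I_n -> F) :
    injective s -> (forall i, a i != 0) ->
  alg_free (fun i => cst m (a i) * var F (s i) + cst m (b i)).
Proof.
move=> s_inj a0 q.
pose u i : {mpoly F[m]} := (a i)%:MP * 'X_(s i) + (b i)%:MP.
(* Injectivity: substituting w is a left inverse of substituting u. *)
pose w j : {mpoly F[n]} :=
  if [pick i | s i == j] is Some i then (a i)^-1%:MP * ('X_i - (b i)%:MP)
  else 0.
have wu i : mmap (@mpolyC n F) w (u i) = 'X_i.
  rewrite rmorphD rmorphM /= !mmapC mmapX mmap1U /w.
  case: pickP => [j /eqP/s_inj->|/(_ i)/eqP//].
  by rewrite mulrA -mpolyCM divff // mpolyC1 mul1r subrK.
(* The values are polynomials, so the relation descends to [{mpoly F[m]}], where [w] can be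
   substituted. *)
have -> : mmap (@cst F m) (fun i => cst m (a i) * var F (s i) + cst m (b i)) q
    = tofrac (mmap (@mpolyC m F) u q).
  rewrite (rmorph_mmap (@tofrac {mpoly F[m]})); apply: eq_mmap => // i.
  by rewrite /= /u tofracD tofracM.
move/eqP; rewrite tofrac_eq0 => /eqP /(congr1 (mmap (@mpolyC n F) w)).
rewrite raddf0 (rmorph_mmap (mmap (@mpolyC n F) w)) => <-.
rewrite -[LHS]mmap_mpolyX; apply: eq_mmap => [c|i] /=; last by rewrite wu.
by rewrite mmapC.
Qed.

(** The underlying polynomial has coefficient -1 at ['X_i] whatever [a] and [b] are. *)
Lemma free_linear_neq0 n m (v : 'I_n -> ratfun F m) i j a b :
  alg_free v -> i != j -> cst m a * v j - v i - cst m b != 0.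
Proof.
move=> free_v ij.
have -> : cst m a * v j - v i - cst m b
    = mmap (@cst F m) v (a%:MP * 'X_j - 'X_i - b%:MP).
  by rewrite !rmorphB rmorphM /= !mmapC !mmapX !mmap1U.
apply: free_mmap_neq0 => //; apply/eqP => /(congr1 (mcoeff U_(i))).
rewrite !mcoeffB mcoeffCM !mcoeffX mcoeffC mcoeff0 eqxx.
rewrite eq_mnm1 [j == i]eq_sym (negbTE ij) mnm1_eq0.
by rewrite !mulr0 sub0r subr0 => /eqP; rewrite oppr_eq0 oner_eq0.
Qed.

Lemma subst_bij n (u v : 'I_n -> ratfun F n) :
    alg_free u -> alg_free v -> (forall i, subst v (u i) = var F i) ->
  cancel (subst u) (subst v).
Proof.
move=> free_u free_v uv f.
by rewrite subst_subst // (eq_subst _ uv) subst_id.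
Qed.

End Subst.

Lemma ord2_ind (P : 'I_2 -> Prop) :
  P (@Ordinal 2 0 isT) -> P (@Ordinal 2 1 isT) -> forall i, P i.
Proof.
by move=> P0 P1 [[|[|//]] lt_i]; rewrite (bool_irrelevance lt_i isT).
Qed.

Lemma ord3_ind (P : 'I_3 -> Prop) : P i1 -> P i2 -> P i3 -> forall i, P i.
Proof.
by move=> P1 P2 P3 [[|[|[|//]]] lt_i]; rewrite (bool_irrelevance lt_i isT).
Qed.

(** * The automorphisms underlying the operators *)

Section Operators.

Variables (F : fieldType) (p : F).
Hypothesis p_neq0 : p != 0.

Local Notation k := (@cst F 2).
Local Notation z1 := (z1 F).
Local Notation z2 := (z2 F).

Definition tF_vars h :=
  tnth [tuple k p^-1 * z1 + k (p^-1 * h); k p * z2 - k h].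
(** The maps z -> (z + h) / p and z -> pz - h are mutually inverse, so inverting the substitution
    exchanges them. *)
Definition tF_inv_vars h :=
  tnth [tuple k p * z1 - k h; k p^-1 * z2 + k (p^-1 * h)].
Definition P_vars := tnth [tuple z2; z1].

Lemma free_pair m (i j : 'I_m) (a a' b b' : F) :
    i != j -> a != 0 -> a' != 0 ->
  alg_free (tnth [tuple cst m a * var F i + cst m b;
                        cst m a' * var F j + cst m b']).
Proof.
move=> ij a0 a0'.
apply: (@eq_free _ _ _ (fun l => cst m (tnth [tuple a; a'] l)
  * var F (tnth [tuple i; j] l) + cst m (tnth [tuple b; b'] l))).
  by apply: ord2_ind.
apply: free_affine; last exact: ord2_ind.
apply: ord2_ind; apply: ord2_ind => // /eqP; first by rewrite (negbTE ij).
by rewrite eq_sym (negbTE ij).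
Qed.

Lemma free_tF h : alg_free (tF_vars h).
Proof.
apply: eq_free (@free_pair 2 (@Ordinal 2 0 isT) (@Ordinal 2 1 isT) p^-1 p
  (p^-1 * h) (- h) _ _ _); rewrite ?invr_eq0 //.
by apply: ord2_ind; rewrite // /tF_vars /tnth /= rmorphN.
Qed.

Lemma free_tF_inv h : alg_free (tF_inv_vars h).
Proof.
apply: eq_free (@free_pair 2 (@Ordinal 2 0 isT) (@Ordinal 2 1 isT) p p^-1
  (- h) (p^-1 * h) _ _ _); rewrite ?invr_eq0 //.
by apply: ord2_ind; rewrite // /tF_inv_vars /tnth /= rmorphN.
Qed.

Lemma free_P : alg_free P_vars.
Proof.
apply: eq_free (@free_pair 2 (@Ordinal 2 1 isT) (@Ordinal 2 0 isT) 1 1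
  0 0 _ _ _); rewrite ?oner_eq0 //.
by apply: ord2_ind; rewrite // /tnth /= rmorph1 rmorph0 mul1r addr0.
Qed.

Lemma free_var_pair m (i j : 'I_m) :
  i != j -> alg_free (tnth [tuple var F i; var F j]).
Proof.
move=> ij; apply: eq_free (@free_pair m i j 1 1 0 0 ij _ _);
  rewrite ?oner_eq0 //.
by apply: ord2_ind; rewrite /tnth /= rmorph1 rmorph0 mul1r addr0.
Qed.

Lemma kpK x : k p^-1 * (k p * x) = x.
Proof. by rewrite mulrA -rmorphM mulVf // rmorph1 mul1r. Qed.

Lemma kpVK x : k p * (k p^-1 * x) = x.
Proof. by rewrite mulrA -rmorphM mulfV // rmorph1 mul1r. Qed.

Lemma tF_varsK h i : subst (tF_inv_vars h) (tF_vars h i) = var F i.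
Proof.
have fv := @free_tF_inv h.
move: i; apply: ord2_ind;
  rewrite /tF_vars /tnth /= ?substB ?substD // substM //.
  by rewrite !subst_cst // subst_var // mulrBr kpK rmorphM subrK.
by rewrite !subst_cst // subst_var // mulrDr rmorphM !kpVK addrK.
Qed.

Lemma tF_inv_varsK h i : subst (tF_vars h) (tF_inv_vars h i) = var F i.
Proof.
have fv := @free_tF h.
move: i; apply: ord2_ind;
  rewrite /tF_inv_vars /tnth /= ?substB ?substD // substM //.
  by rewrite !subst_cst // subst_var // mulrDr rmorphM !kpVK addrK.
by rewrite !subst_cst // subst_var // mulrBr kpK rmorphM subrK.
Qed.

Lemma P_varsK i : subst P_vars (P_vars i) = var F i.
Proof. by move: i; apply: ord2_ind; rewrite (subst_var free_P). Qed.

Definition tF_aut h : autF F :=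
  @AutF F (substm (@free_tF h))
    (Bijective (subst_bij (@free_tF h) (@free_tF_inv h) (tF_varsK h))
               (subst_bij (@free_tF_inv h) (@free_tF h) (tF_inv_varsK h)))
    (subst_cst (@free_tF h)).

Definition P_aut : autF F :=
  @AutF F (substm free_P)
    (Bijective (subst_bij free_P free_P P_varsK)
               (subst_bij free_P free_P P_varsK))
    (subst_cst free_P).

End Operators.

(** * The operators in centred coordinates *)

Section Solution.

Variables (F : fieldType) (n : nat) (h p : F).
Hypotheses (p_neq0 : p != 0) (p_neq1 : p != 1) (pn_neqN1 : p ^+ n != -1).

Local Notation z1 := (z1 F).
Local Notation z2 := (z2 F).

Definition center := h / (p - 1).
Definition weight := (p ^+ n - 1) / (p ^+ n + 1).

Local Notation c m := (cst m center).
Local Notation pi m := (cst m p).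
Local Notation mu m := (cst m weight).

Lemma center_fixed : p^-1 * center + p^-1 * h = center.
Proof. by rewrite /center; field; rewrite p_neq0 subr_eq0 p_neq1. Qed.

Lemma center_fixed' : p * center - h = center.
Proof. by rewrite /center; field; rewrite subr_eq0 p_neq1. Qed.

Lemma cst_pn1_neq0 m : pi m ^+ n + 1 != 0.
Proof.
move: pn_neqN1; rewrite -addr_eq0 -(fmorph_eq0 (@cst F m)).
by rewrite rmorphD rmorphXn rmorph1.
Qed.

Lemma cst_p1_neq0 m : pi m - 1 != 0.
Proof.
by move: p_neq1; rewrite -subr_eq0 -(fmorph_eq0 (@cst F m)) rmorphB rmorph1.
Qed.

Lemma free_var m : alg_free (@var F m).
Proof.
apply: eq_free (@free_affine F m m id (fun=> 1) (fun=> 0) (@inj_id _) _).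
  by move=> i; rewrite rmorph1 rmorph0 mul1r addr0.
by move=> i; apply: oner_neq0.
Qed.

Lemma z_linear_neq0 a b : cst 2 a * z2 - z1 - cst 2 b != 0.
Proof. exact: free_linear_neq0 (@free_var 2) _. Qed.

Lemma cst_weight m : mu m = (pi m ^+ n - 1) / (pi m ^+ n + 1).
Proof. by rewrite fmorph_div rmorphB rmorphD rmorphXn rmorph1. Qed.

Lemma cst_center m : c m = cst m h / (pi m - 1).
Proof. by rewrite fmorph_div rmorphB rmorph1. Qed.

Lemma QopE f :
  Qop p n f = cg_op (pi 2) (mu 2) z1 z2 (Fop p f) (Pop f).
Proof.
rewrite cst_weight -cg_op_modified ?fmorph_eq0 ?cst_pn1_neq0 //.
  by rewrite /Qop rmorphB rmorphD rmorphXn rmorph1 fmorphV.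
by have := z_linear_neq0 p 0; rewrite rmorph0 subr0.
Qed.

Lemma BopE f :
  Bop p h n f = cg_op (pi 2) (mu 2) (z1 - c 2) (z2 - c 2) (tFop p h f) (Pop f).
Proof.
rewrite cst_weight cst_center -cg_op_affine ?cst_p1_neq0 ?cst_pn1_neq0 //.
  by rewrite /Bop !rmorphM !(rmorphB, rmorphD) rmorphXn rmorph1.
exact: z_linear_neq0.
Qed.

Definition B_coef : ratfun F 2 := cg_coef (pi 2) (mu 2) (z1 - c 2) (z2 - c 2).

Definition B_terms : seq (ratfun F 2 * autF F) :=
  [:: (1 - B_coef, tF_aut p_neq0 h); (B_coef, P_aut F)].

Lemma Bop_sum : Bop p h n =1 sum_op B_terms.
Proof. by move=> f; rewrite BopE /sum_op sum_seq2. Qed.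

(** Passes from centred coordinates w to the original ones, z = w + c. *)
Definition shift m l (x : 'I_l -> ratfun F m) i := x i + c m.

(** * The lifted operators at a point given by centred coordinates *)

Section Lift.

Variables i j : 'I_3.
Hypothesis ij : i != j.

(** The automorphism in centred coordinates, where [h] disappears; [lift_F] is its form in the
    original ones. The exchange [act_P] has the same form in both. *)
Definition act_F m (x : 'I_3 -> ratfun F m) l :=
  if l == i then (pi m)^-1 * x i else if l == j then pi m * x j else x l.

Definition act_P m (x : 'I_3 -> ratfun F m) l :=
  if l == i then x j else if l == j then x i else x l.

Definition lift_F l :=
  if l == i then (pi 3)^-1 * var F i + (pi 3)^-1 * cst 3 h
  else if l == j then pi 3 * var F j - cst 3 h else var F l.

Lemma free_lift_F : alg_free lift_F.
Proof.
pose a l := if l == i then p^-1 else if l == j then p else 1.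
pose b l := if l == i then p^-1 * h else if l == j then - h else 0.
apply: eq_free (@free_affine F 3 3 id a b (@inj_id _) _) => l.
  rewrite /lift_F /a /b; case: eqP => [->|_].
    by rewrite rmorphM !fmorphV.
  by case: eqP => [->|_]; rewrite ?rmorphN // rmorph1 rmorph0 mul1r addr0.
by rewrite /a; do 2?case: ifP; rewrite ?invr_eq0 ?oner_eq0.
Qed.

Lemma free_lift_P : alg_free (act_P (@var F 3)).
Proof.
apply: eq_free (@free_affine F 3 3 (tperm i j) (fun=> 1) (fun=> 0)
  (@perm_inj _ _) _) => l; last exact: oner_neq0.
rewrite rmorph1 rmorph0 mul1r addr0 /act_P.
case: tpermP => [->|->|/eqP/negbTE-> /eqP/negbTE->] //; rewrite eqxx //.
by rewrite eq_sym (negbTE ij).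
Qed.

Lemma aut_lift_F f : aut_lift i j (tF_aut p_neq0 h) f = subst lift_F f.
Proof.
have fv := @free_var_pair F _ _ _ ij.
apply: eq_subst => l; rewrite /lift_F /embed /subst2 /=.
rewrite !(subst_var (free_tF p_neq0 (h:=h))).
rewrite /tF_vars /tnth /= substD // substB // !substM //.
rewrite !subst_cst // !subst_var //.
by rewrite /= rmorphM !fmorphV.
Qed.

Lemma aut_lift_P f : aut_lift i j (P_aut F) f = subst (act_P (@var F 3)) f.
Proof.
have fv := @free_var_pair F _ _ _ ij.
apply: eq_subst => l; rewrite /act_P /embed /subst2 /=.
by rewrite !(subst_var (@free_P F)) /P_vars /tnth /= !subst_var.
Qed.

Lemma embed_B_coef :
  embed i j B_coef
  = cg_coef (pi 3) (mu 3) (var F i - c 3) (var F j - c 3).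
Proof.
have fv := @free_var_pair F _ _ _ ij.
rewrite /embed /subst2; apply: etrans (rmorph_cg_coef (substm fv) _ _ _ _) _.
by rewrite /= !substB // !subst_cst // !subst_var.
Qed.

Lemma sum_lift_B f :
  sum_lift B_terms i j f
  = cg_op (pi 3) (mu 3) (var F i - c 3) (var F j - c 3)
      (subst lift_F f) (subst (act_P (@var F 3)) f).
Proof.
have fv := @free_var_pair F _ _ _ ij.
rewrite /sum_lift sum_seq2 [(_, _).1]/= [(_, _).2]/= [(_, _).1]/= [(_, _).2]/=.
rewrite aut_lift_F aut_lift_P.
rewrite /cg_op -embed_B_coef; congr (_ * _ + _).
by rewrite -(rmorph1 (substm fv)); apply: (substB fv).
Qed.

(** Since [center] is a fixed point, (x + c) / p + h / p = x / p + c and p(x + c) - h = px + c. *)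
Lemma subst_lift_F (x : 'I_3 -> ratfun F 3) l : alg_free (shift x) ->
  subst (shift x) (lift_F l) = shift (act_F x) l.
Proof.
move=> fx; rewrite /lift_F /act_F /shift.
case: eqP => _.
  rewrite -fmorphV substD // !substM // !subst_cst // subst_var //.
  rewrite mulrDr -addrA.
  by rewrite -!(rmorphM (@cst F 3)) -rmorphD center_fixed.
case: eqP => _; last by rewrite subst_var.
rewrite substB // substM // !subst_cst // subst_var // mulrDr -addrA.
by rewrite -(rmorphM (@cst F 3)) -rmorphB center_fixed'.
Qed.

Lemma subst_lift_P (x : 'I_3 -> ratfun F 3) l : alg_free (shift x) ->
  subst (shift x) (act_P (@var F 3) l) = shift (act_P x) l.
Proof.
by move=> fx; rewrite /act_P /shift; do 2?case: ifP; rewrite subst_var.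
Qed.

(** The moved point is the image of the free family [lift_F] under evaluation at [shift x]. It is
    free again, so evaluations of composed operators can be iterated. *)
Lemma free_act_F (x : 'I_3 -> ratfun F 3) :
  alg_free (shift x) -> alg_free (shift (act_F x)).
Proof.
move=> fx; apply: eq_free (free_subst fx free_lift_F) => l.
exact: subst_lift_F.
Qed.

Lemma free_act_P (x : 'I_3 -> ratfun F 3) :
  alg_free (shift x) -> alg_free (shift (act_P x)).
Proof.
move=> fx; apply: eq_free (free_subst fx free_lift_P) => l.
exact: subst_lift_P.
Qed.

Lemma subst_sum_lift_B (x : 'I_3 -> ratfun F 3) f : alg_free (shift x) ->
  subst (shift x) (sum_lift B_terms i j f)
  = cg_op (pi 3) (mu 3) (x i) (x j)
      (subst (shift (act_F x)) f) (subst (shift (act_P x)) f).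
Proof.
move=> fx; rewrite sum_lift_B.
have shiftK l : subst (shift x) (var F l - c 3) = x l.
  by rewrite (substB fx) (subst_cst fx) (subst_var fx) addrK.
apply: (rmorph_cg_op (g := substm fx)); rewrite /substm /=.
- exact: subst_cst.
- exact: subst_cst.
- exact: shiftK.
- exact: shiftK.
- apply: etrans (subst_subst fx _ free_lift_F) _.
  by apply: eq_subst => l; apply: subst_lift_F.
- apply: etrans (subst_subst fx _ free_lift_P) _.
  by apply: eq_subst => l; apply: subst_lift_P.
Qed.

End Lift.

(* The point whose shifted coordinates w_i are x, y, z. *)
Definition pt (x y z : ratfun F 3) := shift (tnth [tuple x; y; z]).

(** Encodes [f] by its values at free points, where evaluation is a morphism; under this encoding
    the lifted operators become [cg12], [cg13] and [cg23]. *)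
Definition evals (f : ratfun F 3) g :=
  forall x y z, alg_free (pt x y z) -> subst (pt x y z) f = g x y z.

Lemma evals_lift12 f g :
  evals f g -> evals (sum_lift B_terms i1 i2 f) (cg12 (pi 3) (mu 3) g).
Proof.
move=> fg x y z fx; rewrite subst_sum_lift_B //.
have eF : shift (act_F i1 i2 (tnth [tuple x; y; z])) =1
    pt ((pi 3)^-1 * x) (pi 3 * y) z.
  exact: ord3_ind.
have eP : shift (act_P i1 i2 (tnth [tuple x; y; z])) =1
    pt y x z.
  exact: ord3_ind.
rewrite (eq_subst _ eF) (eq_subst _ eP) !fg //.
- exact: eq_free eP (@free_act_P i1 i2 isT _ fx).
- exact: eq_free eF (@free_act_F i1 i2 _ fx).
Qed.

Lemma evals_lift13 f g :
  evals f g -> evals (sum_lift B_terms i1 i3 f) (cg13 (pi 3) (mu 3) g).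
Proof.
move=> fg x y z fx; rewrite subst_sum_lift_B //.
have eF : shift (act_F i1 i3 (tnth [tuple x; y; z])) =1
    pt ((pi 3)^-1 * x) y (pi 3 * z).
  exact: ord3_ind.
have eP : shift (act_P i1 i3 (tnth [tuple x; y; z])) =1
    pt z y x.
  exact: ord3_ind.
rewrite (eq_subst _ eF) (eq_subst _ eP) !fg //.
- exact: eq_free eP (@free_act_P i1 i3 isT _ fx).
- exact: eq_free eF (@free_act_F i1 i3 _ fx).
Qed.

Lemma evals_lift23 f g :
  evals f g -> evals (sum_lift B_terms i2 i3 f) (cg23 (pi 3) (mu 3) g).
Proof.
move=> fg x y z fx; rewrite subst_sum_lift_B //.
have eF : shift (act_F i2 i3 (tnth [tuple x; y; z])) =1
    pt x ((pi 3)^-1 * y) (pi 3 * z).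
  exact: ord3_ind.
have eP : shift (act_P i2 i3 (tnth [tuple x; y; z])) =1
    pt x z y.
  exact: ord3_ind.
rewrite (eq_subst _ eF) (eq_subst _ eP) !fg //.
- exact: eq_free eP (@free_act_P i2 i3 isT _ fx).
- exact: eq_free eF (@free_act_F i2 i3 _ fx).
Qed.

Lemma evals_subst f : evals f (fun x y z => subst (pt x y z) f).
Proof. by []. Qed.

Lemma evals_subst3 f (s : 'I_3 -> 'I_3) : injective s ->
  evals (subst (fun l => var F (s l)) f)
    (fun x y z => subst (fun l => pt x y z (s l)) f).
Proof.
move=> s_inj x y z fx; rewrite subst_subst //.
  by apply: eq_subst => l; rewrite subst_var.
apply: eq_free (@free_affine F 3 3 s (fun=> 1) (fun=> 0) s_inj _) => l.
  by rewrite rmorph1 rmorph0 mul1r addr0.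
exact: oner_neq0.
Qed.

(** All coordinates are translated by the same [center], so permuting the variables permutes the
    centred coordinates alike. *)
Lemma evals_P123 f : evals (P123 f) (fun x y z => subst (pt z x y) f).
Proof.
move=> x y z fx.
have e : tnth [tuple var F i3; var F i1; var F i2]
    =1 (fun l => var F (tnth [tuple i3; i1; i2] l)) by apply: ord3_ind.
rewrite /P123 /subst3 (eq_subst _ e) evals_subst3 //.
  by apply: eq_subst; apply: ord3_ind.
by apply: ord3_ind; apply: ord3_ind.
Qed.

Lemma evals_P213 f : evals (P213 f) (fun x y z => subst (pt y z x) f).
Proof.
move=> x y z fx.
have e : tnth [tuple var F i2; var F i3; var F i1]
    =1 (fun l => var F (tnth [tuple i2; i3; i1] l)) by apply: ord3_ind.
rewrite /P213 /subst3 (eq_subst _ e) evals_subst3 //.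
  by apply: eq_subst; apply: ord3_ind.
by apply: ord3_ind; apply: ord3_ind.
Qed.

Lemma weight_neq0 : p ^+ n != 1 -> weight != 0.
Proof.
move=> pn1; rewrite mulf_neq0 ?invr_eq0 ?subr_eq0 //.
by rewrite addr_eq0.
Qed.

(** An identity of values becomes one of rational functions at the generic point. The hypothesis
    makes lambda, the square of [weight], nonzero. *)
Lemma Bop_MQYBE : p ^+ n != 1 -> MQYBE (Bop p h n).
Proof.
move=> pn1; exists B_terms; split; first exact: Bop_sum.
exists (weight ^+ 2); split=> [|f]; first by rewrite expf_neq0 ?weight_neq0.
(* The centred coordinates of the generic point: evaluation there is the identity. *)
pose w i := var F i - c 3.
have e : pt (w i1) (w i2) (w i3) =1 @var F 3.
  by apply: ord3_ind; rewrite /pt /shift /tnth /= subrK.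
have fw : alg_free (pt (w i1) (w i2) (w i3)).
  by apply: eq_free (@free_var 3) => i.
have evalsE g g' : evals g g' -> g = g' (w i1) (w i2) (w i3).
  by move=> /(_ _ _ _ fw) <-; rewrite (eq_subst _ e) subst_id.
have w_neq0 a i j : i != j -> cst 3 a * w j - w i != 0.
  (* The constant is what remains of a(z_j - c) - (z_i - c) beside a z_j - z_i. *)
  move=> ij; have := @free_linear_neq0 F 3 3 _ i j a (a * center - center)
    (@free_var 3) ij.
  congr (_ != 0); rewrite /w rmorphB rmorphM /=; ring.
rewrite /=.
(* The composition [\;] applies its left factor first, so the lift in positions 1, 2 is innermost
   here. *)
rewrite
  (evalsE _ _ (evals_lift23 (evals_lift13 (evals_lift12 (evals_subst f))))).
rewrite
  (evalsE _ _ (evals_lift12 (evals_lift13 (evals_lift23 (evals_subst f))))).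
rewrite (evalsE _ _ (evals_lift12 (evals_P123 f))).
rewrite
  (evalsE _ _ (evals_lift23 (evals_P213 f))).
rewrite rmorphXn /=.
apply: (@cg_mqybe _ _ _ (fun x y z => subst (pt x y z) f)).
- by rewrite fmorph_eq0.
- exact: w_neq0.
- exact: w_neq0.
- by rewrite mulrA -rmorphM; apply: w_neq0.
Qed.

(** * Similarity through translation by the fixed point *)

Definition unshift i := var F i - c 2.

Lemma free_shift : alg_free (shift (@var F 2)).
Proof.
apply: eq_free (@free_affine F 2 2 id (fun=> 1) (fun=> center) (@inj_id _) _).
  by move=> i; rewrite rmorph1 mul1r.
by move=> i; apply: oner_neq0.
Qed.

Lemma free_unshift : alg_free unshift.
Proof.
apply: eq_free (@free_affine F 2 2 id (fun=> 1) (fun=> - center) (@inj_id _) _).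
  by move=> i; rewrite rmorph1 mul1r rmorphN.
by move=> i; apply: oner_neq0.
Qed.

Lemma shiftK i : subst unshift (shift (@var F 2) i) = var F i.
Proof.
have fu := free_unshift.
by rewrite (substD fu) (subst_cst fu) (subst_var fu) subrK.
Qed.

Lemma unshiftK i : subst (shift (@var F 2)) (unshift i) = var F i.
Proof.
have fs := free_shift.
by rewrite (substB fs) (subst_cst fs) (subst_var fs) addrK.
Qed.

Lemma tFop_conj f :
  subst unshift (Fop p (subst (shift (@var F 2)) f)) = tFop p h f.
Proof.
have fu := free_unshift; have fs := free_shift.
have fF := @free_tF F p p_neq0 0.
have eF : tnth [tuple cst 2 p^-1 * z1; pi 2 * z2] =1 tF_vars p 0.
  by apply: ord2_ind; rewrite /tF_vars /tnth /= ?mulr0 rmorph0 ?addr0 ?subr0.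
rewrite /Fop /subst2 (eq_subst _ eF) (subst_subst fF _ fs).
rewrite (subst_subst fu); last exact: free_subst.
apply: eq_subst => i; rewrite (substD fF) (subst_cst fF) (subst_var fF).
rewrite (substD fu) (subst_cst fu) -eF; move: i.
apply: ord2_ind; rewrite /tnth /= (substM fu) (subst_cst fu) (subst_var fu).
  (* Only the added [center] is expanded, into c / p + h / p; its first part cancels the -c / p from
     the scaled difference. *)
  rewrite /unshift -{2}center_fixed mulrBr -rmorphM -addrA.
  by rewrite rmorphD addKr.
rewrite /unshift -{2}center_fixed' mulrBr -rmorphM -addrA.
by rewrite rmorphB addKr.
Qed.

Lemma Pop_conj f : subst unshift (Pop (subst (shift (@var F 2)) f)) = Pop f.
Proof.
have fu := free_unshift; have fs := free_shift; have fP := @free_P F.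
rewrite /Pop /subst2 (subst_subst fP _ fs) (subst_subst fu).
  apply: eq_subst => i; rewrite (substD fP) (subst_cst fP) (subst_var fP).
  rewrite (substD fu) (subst_cst fu); move: i.
  by apply: ord2_ind; rewrite /P_vars /tnth /= (subst_var fu) subrK.
exact: free_subst.
Qed.

(** The translation is itself a field morphism: applied to the [cg_op] form of Q, it fixes the
    constants, centres the coordinates and, by the two conjugation lemmas, turns the two function
    values into those of B. *)
Lemma Bop_similar : similar_op (Bop p h n) (Qop p n).
Proof.
have fu := free_unshift; have fs := free_shift.
exists (subst unshift), (subst (shift (@var F 2))); split.
- by split=> [f g|a f]; rewrite ?(substD fu) // (substM fu) (subst_cst fu).
- exact: subst_bij fu fs unshiftK.
- exact: subst_bij fs fu shiftK.
move=> f; rewrite BopE /= QopE; symmetry.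
apply: (rmorph_cg_op (g := substm fu)); rewrite /substm /=.
- exact: subst_cst.
- exact: subst_cst.
- exact: subst_var.
- exact: subst_var.
- exact: tFop_conj.
- exact: Pop_conj.
Qed.

End Solution.

(** The condition on -1 keeps the denominator p^n + 1 of both operators nonzero. If p^n = 1, then mu
    = 0 and lambda = mu^2 vanishes, so p^n != 1 is asked for the MQYBE; the similarity covers that
    case too. *)
Theorem proposition2p1 (F : closedFieldType) (charF0 : [pchar F] =i pred0)
    (n : nat) (n_gt0 : (0 < n)%N) (h p : F) (p_neq0 : p != 0) (p_neq1 : p != 1)
    (pn_neqN1 : p ^+ n != -1) :
  (p ^+ n != 1 -> MQYBE (Bop p h n)) /\ similar_op (Bop p h n) (Qop p n).
Proof.
split; last exact: Bop_similar.
exact: Bop_MQYBE.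
Qed.
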